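(* Let $E$ be a finite set, $\Gamma_x$ ($x\in E$) finite groups, $\mathcal{G}=\prod_{x\in E}\Gamma_x$, $\mathcal{H}\le\mathcal{G}$. Write $\mathbb{C}[\mathcal{G}/\mathcal{H}]\cong\tau_1\oplus\cdots\oplus\tau_N$ as a direct sum of irreducible representations of $\mathcal{G}$ (so $\mathcal{R}(\mathcal{H})=\{\tau_1,\dots,\tau_N\}$ as a multiset). Then for every real $b>1$ and every positive integer $k$, $$\sum_{\substack{(i_1,\dots,i_k)\in[N]^k\\ \bigcap_{j=1}^k\mathrm{triv}(\tau_{i_j})=\emptyset}}\ \prod_{j=1}^k\dim\tau_{i_j}=\chi_{P^*}(b^k).$$
   Context: $\mathbb{C}[\mathcal{G}/\mathcal{H}]$ is the complex permutation representation of $\mathcal{G}$ on the cosets, $g'\cdot g\mathcal{H}=g'g\mathcal{H}$. Each irreducible representation $\rho$ of $\mathcal{G}$ is equivalent to $\bigotimes_{x\in E}\rho_x$ with $\rho_x$ irreducible for $\Gamma_x$; $\mathrm{triv}(\rho)=\{x\in E:\rho_x\text{ is trivial}\}$. $\mathcal{H}_S$ is the image of $\mathcal{H}$ under the projection $\mathcal{G}\to\prod_{x\in S}\Gamma_x$ ($\mathcal H_\emptyset$ trivial); $P(\mathcal{H},b)=(E,r)$ with $r(S)=\log_b|\mathcal{H}_S|$. With $\mathbf a_x=\log_b|\Gamma_x|$, $P^*=(E,r^* )$ where $r^*(S)=r(E-S)+\sum_{x\in S}\mathbf a_x-r(E)$. The characteristic polynomial of a polymatroid $(E,r')$ is $\chi(t)=\sum_{S\subseteq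 E}(-1)^{|S|}t^{r'(E)-r'(S)}$. *)

(* Defs.v *)
From HB Require Import structures.
From mathcomp Require Import all_boot all_order all_fingroup all_algebra.
From mathcomp Require Import mxrepresentation character.
From mathcomp Require Import boolp reals exp.
From mathcomp Require Import complex.

Set Implicit Arguments.
Unset Strict Implicit.
Unset Printing Implicit Defensive.

Import Order.TTheory GroupScope GRing.Theory Num.Theory.
Local Open Scope ring_scope.

Section StandardRepresentations.
Variables (F : fieldType) (gT : finGroupType) (G : {group gT}).

(* The left action g' . gH = g'gH on the left cosets, as matrices acting on
   column vectors: the column indexed by C has its only 1 in row g *: C, so that
   g |-> lcoset_mx g is multiplicative, as mx_repr requires. *)
Definition lcoset_mx (H : {group gT}) (g : gT) : 'M[F]_#|lcosets H G| :=
  \matrix_(i, j) (enum_val i == (g *: enum_val j)%g)%:R.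

Lemma lcoset_mx_repr (H : {group gT}) : mx_repr G (lcoset_mx H).
Proof.
split=> [|x y Gx Gy]; apply/matrixP=> i j; rewrite !mxE.
  by rewrite lcoset1 (inj_eq enum_val_inj).
have GyC : (y *: enum_val j)%g \in lcosets H G.
  have /lcosetsP[z Gz ->] := enum_valP j.
  by rewrite -lcosetM; apply/lcosetsP; exists (y * z)%g; rewrite ?groupM.
pose l0 := enum_rank_in GyC (y *: enum_val j)%g.
have l0E : enum_val l0 = (y *: enum_val j)%g by rewrite enum_rankK_in.
rewrite (bigD1 l0) //= big1 ?addr0 => [|l ne_l].
  by rewrite !mxE l0E eqxx mulr1 lcosetM.
by rewrite !mxE -l0E (inj_eq enum_val_inj) (negPf ne_l) mulr0.
Qed.

Definition lcoset_repr (H : {group gT}) := MxRepresentation (lcoset_mx_repr H).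

Lemma triv_mx_repr : mx_repr G (fun _ : gT => 1%:M : 'M[F]_1).
Proof. by split=> // x y _ _; rewrite mulmx1. Qed.

Definition triv_grepr : representation F G :=
  Representation (MxRepresentation triv_mx_repr).

Definition prod_grepr (rG1 rG2 : representation F G) : representation F G :=
  Representation (prod_repr rG1 rG2).

End StandardRepresentations.

Section ProductGroup.
Variables (E : finType) (Gamma : E -> finGroupType).
Local Notation gprod := {dffun forall x : E, Gamma x}.

Section Tensor.
Variable F : fieldType.

Lemma factor_mx_repr (x : E) (rho : representation F [set: Gamma x]) :
  mx_repr [set: gprod] (fun g : gprod => rho (g x)).
Proof.
split=> [|g h _ _]; first by rewrite oneg_ffun repr_mx1.
by rewrite mulg_ffun repr_mxM ?inE.
Qed.

Definition factor_grepr (x : E) (rho : representation F [set: Gamma x]) :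
  representation F [set: gprod] :=
  Representation (MxRepresentation (factor_mx_repr rho)).

(* The external tensor product of the rho x, on which g acts as the Kronecker
   product of the matrices rho x (g x). *)
Definition tensor_grepr (rho : forall x, representation F [set: Gamma x]) :
    representation F [set: gprod] :=
  \big[@prod_grepr F _ _/triv_grepr F _]_(x : E) factor_grepr (rho x).

(* The tensor factors of an irreducible tau exist (over the complex numbers)
   and are unique up to equivalence, so the existential does not depend on the
   choice of the family rho. *)
Definition triv_set (tau : representation F [set: gprod]) : {set E} :=
  [set x | `[< exists rho : forall y, representation F [set: Gamma y],
      [/\ forall y, mx_irreducible (rho y),
          mx_rsim tau (tensor_grepr rho)
        & mx_rsim (rho x) (triv_grepr F [set: Gamma x])] >]].

End Tensor.

Definition restrict (S : {set E}) (g : gprod) :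
    {dffun forall x : {y : E | y \in S}, Gamma (val x)} :=
  [ffun x => g (val x)].

Definition proj_image (S : {set E}) (H : {group gprod}) := restrict S @: H.

End ProductGroup.

Section Polymatroid.
Variables (R : realType) (E : finType).

(* A polymatroid on E is given by its rank function {set E} -> R. *)

Definition log (b x : R) : R := ln x / ln b.

Definition group_rank (Gamma : E -> finGroupType)
    (H : {group {dffun forall x : E, Gamma x}}) (b : R) (S : {set E}) : R :=
  log b #|proj_image S H|%:R.

Definition dual_rank (a : E -> R) (r : {set E} -> R) (S : {set E}) : R :=
  r (~: S) + \sum_(x in S) a x - r [set: E].

(* The exponents are real, so this is a generalized polynomial in t > 0. *)
Definition char_poly_rank (r : {set E} -> R) (t : R) : R :=
  \sum_(S : {set E}) (-1) ^+ #|S| * t `^ (r [set: E] - r S).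

End Polymatroid.

(* Main.v *)
(* Let G_S be the subgroup of those g with g x = 1 for all x outside S.  By
   inclusion-exclusion over S, the left-hand side is the alternating sum of the
   k-th powers of the total dimensions d_S of the tau_i with S contained in
   triv(tau_i).  For tau_i irreducible, S is contained in triv(tau_i) iff G_S
   acts trivially, and otherwise the sum of the operators of the normal subgroup
   G_S vanishes; so d_S |G_S| is the sum over G_S of the trace of C[G/H], which
   counts fixed cosets and equals [G : H] |G_S :&: H|.  Hence d_S |H_{E-S}| is
   the product of the |Gamma_x| over x outside S, and
   log_b d_S = r^*(E) - r^*(S).

   That every irreducible tau is a tensor product of irreducibles is read off
   the regular characters: the product over x of the regular characters of the
   Gamma_x is |G| times the indicator of 1 and expands into characters of tensor
   products T of irreducibles, so for some T the operator
   sum_g tr(T(g^-1)) tau(g) is nonzero, which yields a nonzero homomorphism from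
   T to tau; T is irreducible because its operators span the full matrix
   algebra. *)
Require Import Defs.
From HB Require Import structures.
From mathcomp Require Import all_boot all_order all_fingroup all_algebra.
From mathcomp Require Import pgroup mxrepresentation character.
From mathcomp Require Import boolp reals exp.
From mathcomp Require Import complex ring.

Set Implicit Arguments.
Unset Strict Implicit.
Unset Printing Implicit Defensive.

Import Order.TTheory GRing.Theory Num.Theory.
Local Open Scope ring_scope.

(** * Kronecker products: bilinearity, and generation of all matrices *)

Section KroneckerProduct.
Variable F : fieldType.

Lemma tprod_linearl m1 n1 m2 n2 (B : 'M[F]_(m2, n2)) :
  linear (fun A : 'M_(m1, n1) => tprod A B).
Proof.
elim: m1 => [|m1 IH] a A A' /=; first by rewrite scaler0 addr0.
rewrite [usubmx _]linearP [dsubmx _]linearP IH -!trowbE linearP.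
by rewrite -add_col_mx -scale_col_mx.
Qed.

Lemma tprod_linearr m1 n1 m2 n2 (A : 'M[F]_(m1, n1)) :
  linear (fun B : 'M_(m2, n2) => tprod A B).
Proof.
elim: m1 A => [|m1 IH] A a B B' /=; first by rewrite scaler0 addr0.
by rewrite IH linearP -add_col_mx -scale_col_mx.
Qed.

Lemma tprod_sum_scalel m1 n1 m2 n2 I (r : seq I) (P : pred I) (a : I -> F)
    (A : I -> 'M[F]_(m1, n1)) (B : 'M[F]_(m2, n2)) :
  tprod (\sum_(i <- r | P i) a i *: A i) B
    = \sum_(i <- r | P i) a i *: tprod (A i) B.
Proof.
pose f := GRing.isLinear.Build _ _ _ _ _ (@tprod_linearl m1 n1 m2 n2 B).
pose g : {linear _ -> _} := HB.pack (fun A : 'M_(m1, n1) => tprod A B) f.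
rewrite -[LHS]/(g _) linear_sum; apply: eq_bigr => i _.
by rewrite linearZ_LR.
Qed.

Lemma tprod_sum_scaler m1 n1 m2 n2 I (r : seq I) (P : pred I) (a : I -> F)
    (A : 'M[F]_(m1, n1)) (B : I -> 'M[F]_(m2, n2)) :
  tprod A (\sum_(i <- r | P i) a i *: B i)
    = \sum_(i <- r | P i) a i *: tprod A (B i).
Proof.
pose f := GRing.isLinear.Build _ _ _ _ _ (@tprod_linearr m1 n1 m2 n2 A).
pose g : {linear _ -> _} := HB.pack (fun B : 'M_(m2, n2) => tprod A B) f.
rewrite -[LHS]/(g _) linear_sum; apply: eq_bigr => i _.
by rewrite linearZ_LR.
Qed.

(** Blocks of width [n2] are split off one at a time; each is the product of a unit row vector with
    that block. *)
Lemma trow_ind m2 n1 n2 (P : 'M[F]_(m2, n1 * n2) -> Prop) :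
    P 0 -> (forall M N, P M -> P N -> P (M + N)) ->
    (forall (A : 'rV_n1) (B : 'M_(m2, n2)), P (trow A B)) ->
  forall M, P M.
Proof.
elim: n1 P => [|n1 IH] P P0 PD Pt M; first by rewrite [M]thinmx0.
rewrite -[M](@hsubmxK _ m2 n2 (n1 * n2)).
have -> (X : 'M[F]_(m2, n2)) (Y : 'M_(m2, n1 * n2)) :
    row_mx X Y = row_mx X 0 + row_mx 0 Y by rewrite add_row_mx addr0 add0r.
apply: (PD).
  have := Pt (row_mx 1%:M 0 : 'M_(1, 1 + n1))
             (lsubmx (M : 'M_(m2, n2 + n1 * n2))).
  by rewrite /= row_mxKl row_mxKr trow0 mxE eqxx scale1r.
apply: (IH (fun N => P (row_mx 0 N))) => [|M' N' PM PN|A B].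
- by rewrite row_mx0.
- by rewrite -[0](addr0 0) -add_row_mx; apply: PD.
- have := Pt (row_mx 0 A : 'M_(1, 1 + n1)) B.
  by rewrite /= row_mxKl row_mxKr mxE scale0r.
Qed.

(** Kronecker products generate all matrices additively, which is what makes operators of a tensor
    product span. Block rows are peeled off and each is left to [trow_ind]. *)
Lemma tprod_ind m1 m2 n1 n2 (P : 'M[F]_(m1 * m2, n1 * n2) -> Prop) :
    P 0 -> (forall M N, P M -> P N -> P (M + N)) ->
    (forall (A : 'M_(m1, n1)) (B : 'M_(m2, n2)), P (tprod A B)) ->
  forall M, P M.
Proof.
elim: m1 P => [|m1 IH] P P0 PD Pt M; first by rewrite [M]flatmx0.
have tprod0 m (B : 'M[F]_(m2, n2)) : tprod (0 : 'M_(m, n1)) B = 0.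
  have := tprod_linearl B (-1) (0 : 'M_(m, n1)) 0.
  by rewrite scaler0 addr0 scaleN1r addNr.
rewrite -[M](@vsubmxK _ m2 (m1 * m2) (n1 * n2)).
have -> (X : 'M[F]_(m2, n1 * n2)) (Y : 'M_(m1 * m2, n1 * n2)) :
    col_mx X Y = col_mx X 0 + col_mx 0 Y by rewrite add_col_mx addr0 add0r.
apply: (PD).
  apply: (@trow_ind _ _ _ (fun N => P (col_mx N 0))) => [|M' N' PM PN|A B].
  - by rewrite col_mx0.
  - by rewrite -[0](addr0 0) -add_col_mx; apply: PD.
  - have := Pt (col_mx A 0 : 'M_(1 + m1, n1)) B.
    by rewrite /= col_mxKu col_mxKd tprod0.
apply: (IH (fun N => P (col_mx 0 N))) => [|M' N' PM PN|A B].
- by rewrite col_mx0.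
- by rewrite -[0](addr0 0) -add_col_mx; apply: PD.
- have := Pt (col_mx 0 A : 'M_(1 + m1, n1)) B.
  by rewrite /= col_mxKu col_mxKd trow0.
Qed.

End KroneckerProduct.

(** * Irreducible representations: normal subgroups, Schur's lemma, traces *)

Section IrreducibleRepresentations.
Variables (F : fieldType) (gT : finGroupType) (G : {group gT}).

(** As [K] is normal, its fixed space is a submodule, hence zero or everything; the rows of the sum
    lie in that space. *)
Lemma sum_normal_irr n (rG : mx_representation F G n) (K : {group gT}) :
    mx_irreducible rG -> (K <| G)%g ->
  \sum_(x in K) rG x = if K \subset rker rG then #|K|%:R%:M else 0.
Proof.
move=> irrG nsKG; have sKG := normal_sub nsKG.
case: ifPn => [sKr | nsKr].
  rewrite (eq_bigr (fun=> 1%:M)) => [|x Kx].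
    by rewrite sumr_const -scaler_nat scalemx1.
  by have /rkerP[] := subsetP sKr x Kx.
have fix0 : rfix_mx rG K = 0.
  apply: contraNeq nsKr => nz.
  have [_ /(_ _ (normal_rfix_mx_module rG nsKG) nz)] := (mx_irrP rG).1 irrG.
  by rewrite -sub1mx -rfix_mx_rstabC.
apply/eqP; rewrite -submx0 -[X in (_ <= X)%MS]fix0; apply/rfix_mxP => x Kx.
rewrite mulmx_suml [RHS](reindex_inj (mulIg x)) /=.
rewrite [RHS](eq_bigl (fun y => y \in K)) => [|y]; last by rewrite groupMr.
by apply: eq_bigr => y Ky; rewrite repr_mxM // (subsetP sKG).
Qed.

(** Under a trivial action every line is a submodule, which forces degree 1. *)
Lemma irr_rker_full_rsim_triv (rG : representation F G) :
  mx_irreducible rG -> G \subset rker rG -> mx_rsim rG (triv_grepr F G).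
Proof.
case: rG => n rG /= irrG /subsetP rkG.
have [n_gt0 minG] := (mx_irrP rG).1 irrG.
have triv_rG x : x \in G -> rG x = 1%:M by move/rkG/rkerP=> [].
pose u : 'rV[F]_n := delta_mx 0 (Ordinal n_gt0).
have modU : mxmodule rG <<u>>%MS.
  by apply/mxmoduleP=> x Gx; rewrite triv_rG // mulmx1.
have nzu : <<u>>%MS != 0.
  by rewrite -mxrank_eq0 genmxE mxrank_delta.
have := minG _ modU nzu; rewrite /row_full genmxE mxrank_delta => /eqP n1.
case: _ / n1 in rG irrG rkG triv_rG {n_gt0 minG u modU nzu} *.
exists 1%:M => // [|x Gx]; first by rewrite row_free_unit unitmx1.
by rewrite mulmx1 mul1mx triv_rG.
Qed.

(** Schur's lemma: the kernel and the row space of [B] are submodules, so [B] is square and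
    invertible. *)
Lemma irr_hom_rsim n1 n2 (rG1 : mx_representation F G n1)
    (rG2 : mx_representation F G n2) (B : 'M_(n1, n2)) :
    mx_irreducible rG1 -> mx_irreducible rG2 -> B != 0 ->
    (forall x, x \in G -> rG1 x *m B = B *m rG2 x) ->
  mx_rsim rG1 rG2.
Proof.
move=> /mx_irrP[_ min1] /mx_irrP[_ min2] nzB homB.
have freeB : row_free B.
  rewrite -kermx_eq0; apply: contraR nzB => /min1 fullK.
  have /fullK : mxmodule rG1 (kermx B).
    apply/mxmoduleP=> x Gx; apply/sub_kermxP.
    by rewrite -mulmxA homB // mulmxA mulmx_ker mul0mx.
  by rewrite -sub1mx => /sub_kermxP; rewrite mul1mx => ->.
have fullB : row_full B.
  have modB : mxmodule rG2 <<B>>%MS.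
    apply/mxmoduleP=> x Gx; rewrite genmxE (eqmxMr _ (genmxE B)).
    by rewrite -homB // submxMl.
  have := min2 _ modB; rewrite -mxrank_eq0 /row_full !genmxE mxrank_eq0.
  exact.
by exists B => //; rewrite -(eqP fullB) (eqP freeB).
Qed.

(** A substitute for character orthogonality: averaging a suitable matrix unit over [G] turns the
    nonzero operator into a nonzero intertwiner. *)
Lemma irr_conv_trace_rsim n1 n2 (rG1 : mx_representation F G n1)
    (rG2 : mx_representation F G n2) :
    mx_irreducible rG1 -> mx_irreducible rG2 ->
    \sum_(x in G) \tr (rG1 x^-1%g) *: rG2 x != 0 ->
  mx_rsim rG2 rG1.
Proof.
move=> irr1 irr2 nz; apply: mx_rsim_sym.
have [i nzi] : exists i, \sum_(x in G) rG1 x^-1%g i i *: rG2 x != 0.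
  apply/existsP; apply: contraR nz => /existsPn nz.
  rewrite /mxtrace; under eq_bigr do rewrite scaler_suml.
  rewrite exchange_big big1 // => i _; apply/eqP.
  by have := nz i; rewrite negbK.
have [j [k nzjk]] :
    exists j k, (\sum_(x in G) rG1 x^-1%g i i *: rG2 x) j k != 0.
  have [/matrixP eq0|] := eqVneq (\sum_(x in G) rG1 x^-1%g i i *: rG2 x) 0.
    by case/eqP: nzi; apply/matrixP.
  by case/matrix0Pn=> j [k]; exists j, k.
(* Entry (i, k) of [P] is the entry (j, k) just found to be nonzero. *)
pose P := \sum_(x in G) rG1 x^-1%g *m delta_mx i j *m rG2 x.
apply: (@irr_hom_rsim _ _ _ _ P) => // [|y Gy].
  apply: contraNneq nzjk => /matrixP/(_ i k); rewrite mxE => <-.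
  rewrite /P !summxE; apply/eqP; apply: eq_bigr => x Gx; rewrite !mxE.
  rewrite (bigD1 j) //= big1 ?addr0 => [|l ne_lj]; last first.
    rewrite -[delta_mx i j](mul_delta_mx (0 : 'I_1)) mulmxA.
    by rewrite !mxE big_ord1 !mxE (negPf ne_lj) mulr0 mul0r.
  congr (_ * _); rewrite -[delta_mx i j](mul_delta_mx (0 : 'I_1)) mulmxA -colE.
  by rewrite !mxE big_ord1 !mxE !eqxx mulr1.
rewrite mulmx_sumr mulmx_suml [RHS](reindex_inj (mulIg y^-1%g)) /=.
rewrite [RHS](eq_bigl (fun x => x \in G)) => [|x]; last first.
  by rewrite groupMr ?groupV.
apply: eq_bigr => x Gx; rewrite -[RHS]mulmxA -repr_mxM ?groupM ?groupV // mulgKV.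
by rewrite invMg invgK repr_mxM ?groupV // !mulmxA.
Qed.

Lemma mxtrace_regular_mx x :
  x \in G -> \tr (regular_repr F G x) = if x == 1%g then #|G|%:R else 0.
Proof.
move=> Gx; have [->|nx1] := eqVneq; first by rewrite repr_mx1 mxtrace1.
rewrite /mxtrace big1 // => i _; rewrite /= mxE mxE eqxx /=.
case: eqP => // /(congr1 enum_val); rewrite gring_indexK ?groupM ?enum_valP //.
by rewrite -[LHS]mulg1 => /mulgI x1; rewrite x1 eqxx in nx1.
Qed.

End IrreducibleRepresentations.

(** Dependent families are re-encoded as functions into a tagged union, where ordinary
    distributivity applies. *)
Lemma bigA_distr_fprod (R : comPzSemiRingType) (I : finType) (T : I -> finType)
    (f : forall i, T i -> R) :
  \prod_i \sum_(j : T i) f i j = \sum_(t : fprod T) \prod_i f i (t i).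
Proof.
pose P i := [ffun j : T i => f i j].
transitivity (\prod_i \sum_j P i j).
  by apply: eq_bigr => i _; apply: eq_bigr => j _; rewrite ffunE.
transitivity (\sum_(t : fprod T) \prod_i P i (t i)); last first.
  by apply: eq_bigr => t _; apply: eq_bigr => i _; rewrite ffunE.
rewrite [RHS]big_fprod.
(* The default 0 of [untag] is never reached, since [j] carries the tag [i]. *)
transitivity (\prod_i \sum_(j in tagged_with T i) untag 0 (P i) j); last first.
  exact: bigA_distr_big_dep.
by apply: eq_bigr => i _; rewrite (big_tag (fun i j => P i j)).
Qed.

(** * Irreducible representations of the product group as tensor products *)

Section ProductGroupRepresentations.
Variables (E : finType) (Gamma : E -> finGroupType).
Local Notation gprod := {dffun forall x : E, Gamma x}.

(** The subgroup G_S, written as a product of full and trivial factors so that its order is a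
    product. *)
Definition supported_group (S : {set E}) : {group gprod} :=
  setXn_group (fun x => if x \in S then [set: Gamma x]%G else 1%G).

Arguments supported_group : simpl never.

Lemma supported_groupP (S : {set E}) (g : gprod) :
  reflect (forall x, x \notin S -> g x = 1%g) (g \in supported_group S).
Proof.
apply: (iffP setXnP) => [gS x nSx | gS x].
  by have := gS x; rewrite (negPf nSx) => /set1P.
by case: ifPn => [_|/gS ->]; rewrite inE.
Qed.

Lemma supported_group_normal S : (supported_group S <| [set: gprod])%g.
Proof.
rewrite /normal subsetT; apply/subsetP=> g _; rewrite inE.
apply/subsetP=> _ /imsetP[h /supported_groupP hS ->].
apply/supported_groupP=> x nSx.
by rewrite conjgE !mulg_ffun invg_ffun hS // mul1g mulVg.
Qed.

Lemma card_supported_group S :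
  #|supported_group S| = (\prod_(x in S) #|Gamma x|)%N.
Proof.
rewrite cardsXn [RHS]big_mkcond /=; apply: eq_bigr => x _.
by case: ifP; rewrite ?cardsT ?cards1.
Qed.

Lemma mem_dfung1_supported (S : {set E}) x (h : Gamma x) :
  x \in S -> dfung1 h \in supported_group S.
Proof.
move=> Sx; apply/supported_groupP => y nSy; rewrite dfung1_dflt //.
by apply: contraNneq nSy => <-.
Qed.

Section Tensor.
Variable F : fieldType.
Implicit Type rho : forall x, representation F [set: Gamma x].

(** A list of indices allows induction, while the group acting remains the whole product. *)
Definition partial_tensor rho (r : seq E) : representation F [set: gprod] :=
  \big[@prod_grepr F _ _/triv_grepr F _]_(x <- r) factor_grepr (rho x).

Lemma mxtrace_tensor_grepr rho (g : gprod) :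
  \tr (tensor_grepr rho g) = \prod_x \tr (rho x (g x)).
Proof.
rewrite /tensor_grepr.
apply: (big_morph (fun T : representation F [set: gprod] => \tr (T g))) => /=.
  by move=> T1 T2; rewrite mxtrace_prod.
by rewrite mxtrace1.
Qed.

Lemma rdegree_tensor_grepr rho :
  rdegree (tensor_grepr rho) = (\prod_x rdegree (rho x))%N.
Proof. exact: big_morph. Qed.

Lemma partial_tensor_outside rho r (g : gprod) :
  {in r, forall x, g x = 1%g} -> partial_tensor rho r g = 1%:M.
Proof.
move=> g1; rewrite /partial_tensor big_seq.
apply: (big_ind (fun T : representation F [set: gprod] => T g = 1%:M)) => //=.
  by move=> T1 T2 -> ->; rewrite tprod1.
by move=> x /g1 ->; rewrite repr_mx1.
Qed.

(** Restricting to elements supported on [r] drives the induction: a new coordinate and the old ones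
    then vary independently, so the operators include all products of spanning families of the two
    factors. *)
Lemma partial_tensor_span rho r :
    (forall x, mx_absolutely_irreducible (rho x)) -> uniq r ->
  (0 < rdegree (partial_tensor rho r))%N /\
  forall A, exists a : gprod -> F,
    A = \sum_(g in supported_group [set x in r]) a g *: partial_tensor rho r g.
Proof.
move=> irr_rho; elim: r => [_|x r IH] /=.
  rewrite /partial_tensor big_nil; split=> // A.
  exists (fun g => A 0 0 *+ (g == 1%g)).
  rewrite (bigD1 1%g) ?group1 //= eqxx big1 => [|g /andP[_ /negPf ->]].
    by rewrite addr0 scalemx1 [LHS]mx11_scalar.
  by rewrite scale0r.
case/andP=> nrx /IH[dgt0 spanT] {IH}.
have /mx_abs_irrP[d_gt0 [c rho_c]] := irr_rho x.
rewrite /partial_tensor big_cons -/(partial_tensor rho r).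
set T := partial_tensor rho r in dgt0 spanT *.
have T1 (h : Gamma x) : T (dfung1 h) = 1%:M.
  apply: partial_tensor_outside => y ry; rewrite dfung1_dflt //.
  by apply: contraNneq nrx => ->.
split; first by rewrite /= muln_gt0 d_gt0.
pose K := supported_group [set y in x :: r].
have sKK : supported_group [set y in r] \subset K.
  apply/subsetP=> g /supported_groupP gr; apply/supported_groupP=> y.
  by rewrite !inE negb_or => /andP[_ nry]; apply: gr; rewrite inE.
set TT := prod_grepr _ _.
pose rK := subg_repr TT (subsetT K).
suff spanTT (M : 'M_(rdegree TT)) : (M \in enveloping_algebra_mx rK)%MS.
  move=> A; have /envelop_mxP[a ->] := spanTT A.
  by exists a; apply: eq_bigr.
move: M; apply: tprod_ind => [|M N|A B].
- by rewrite linear0 sub0mx.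
- by rewrite linearD; apply: addmx_sub.
rewrite [A]rho_c tprod_sum_scalel; have [b ->] := spanT B.
rewrite linear_sum summx_sub // => h _; rewrite linearZ scalemx_sub //.
rewrite tprod_sum_scaler linear_sum summx_sub // => k Kk.
rewrite linearZ scalemx_sub //=.
(* The first factor sees only [h], because [k] is 1 at [x]; the second sees only [k], because [T]
   ignores the coordinate [x]. *)
have Khk : (dfung1 h * k)%g \in K.
  apply: groupM; last exact: (subsetP sKK).
  by apply: mem_dfung1_supported; rewrite !inE eqxx.
have kx : k x = 1%g by apply: (supported_groupP _ _ Kk); rewrite inE.
have <- : TT (dfung1 h * k)%g = tprod (rho x h) (T k).
  by rewrite /TT /= mulg_ffun dfung1_id kx mulg1 repr_mxM ?inE // T1 mul1mx.
by apply: (envelop_mx_id rK).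
Qed.

(** Once the list exhausts [E], the support condition is void and the operators span the full matrix
    algebra. *)
Lemma tensor_grepr_abs_irr rho :
    (forall x, mx_absolutely_irreducible (rho x)) ->
  mx_absolutely_irreducible (tensor_grepr rho).
Proof.
move=> irr_rho; have [] := partial_tensor_span irr_rho (index_enum_uniq E).
rewrite -[partial_tensor _ _]/(tensor_grepr rho) => dgt0 spanT.
apply/mx_abs_irrP; split=> //.
have /choice[a aP] := spanT; exists (fun g A => a A g) => A.
rewrite [LHS]aP; apply: eq_bigl => g; rewrite in_setT.
by apply/supported_groupP => x; rewrite inE mem_index_enum.
Qed.

Lemma sub_rker_triv_set (tau : representation F [set: gprod]) x :
  x \in triv_set tau -> supported_group [set x] \subset rker tau.
Proof.
rewrite inE => /asboolP[rho [_ sim_tau sim_x]].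
rewrite (rker_mx_rsim sim_tau); apply/subsetP=> g /supported_groupP gx.
apply/rkerP; split; first by rewrite inE.
rewrite /tensor_grepr.
apply: (big_ind (fun T : representation F [set: gprod] => T g = 1%:M)) => //=.
  by move=> T1 T2 -> ->; rewrite tprod1.
move=> y _; have [->|ne_yx] := eqVneq y x.
  exact: mx_rsim_scalar (in_setT _) (mx_rsim_sym sim_x) _.
by rewrite gx ?inE // repr_mx1.
Qed.

End Tensor.

Section ClosedField.
Variable F : numClosedFieldType.

Lemma irr_tensor_factors (tau : representation F [set: gprod]) :
    mx_irreducible tau ->
  exists rho : forall x, representation F [set: Gamma x],
    (forall x, mx_irreducible (rho x)) /\ mx_rsim tau (tensor_grepr rho).
Proof.
move=> irr_tau.
have splitF x : group_splitting_field F [set: Gamma x].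
  exact: group_closure_closed_field.
have F'G x : ([pchar F]^'.-group [set: Gamma x])%g.
  by apply/pgroupP=> p _; rewrite inE /= pchar_num.
pose sG x : irrType F [set: Gamma x] := DecSocleType _.
pose rho (t : fprod sG) x := Representation (irr_repr (t x)).
have irr_rho t x : mx_irreducible (rho t x) by apply: socle_irr.
have [t nz_t] : exists t : fprod sG,
    \sum_(g in [set: gprod]) \tr (tensor_grepr (rho t) g^-1%g) *: tau g != 0.
  apply/existsP; apply: contraT => /existsPn eq0.
  (* Each regular character is the sum of the irreducible characters weighted by degree;
     distributing the product over [x] gives a combination of the sums assumed to vanish. *)
  have : \sum_(g in [set: gprod])
     (\prod_x \tr (regular_repr F [set: Gamma x] (g^-1%g x))) *: tau g = 0.
    transitivity (\sum_(t : fprod sG) (\prod_x (rdegree (rho t x))%:R : F) *: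
      \sum_(g in [set: gprod]) \tr (tensor_grepr (rho t) g^-1%g) *: tau g).
      under [RHS]eq_bigr do rewrite scaler_sumr.
      rewrite [RHS]exchange_big; apply: eq_bigr => g _ /=.
      under [RHS]eq_bigr do rewrite scalerA.
      rewrite -scaler_suml; congr (_ *: _).
      under eq_bigr => x _ do
        rewrite (mxtrace_regular_pchar (sG x) (F'G x) (splitF x)) ?inE //.
      rewrite bigA_distr_fprod; apply: eq_bigr => t _.
      rewrite mxtrace_tensor_grepr -big_split; apply: eq_bigr => x _ /=.
      by rewrite mulr_natl.
    apply: big1 => t _; have := eq0 t; rewrite negbK => /eqP ->.
    by rewrite scaler0.
  (* Only g = 1 survives, leaving the product of the group orders times the identity of positive
     size, which cannot be 0. *)
  rewrite (bigD1 1%g) ?inE //= [X in _ + X]big1 => [|g /andP[_ nz_g]].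
    rewrite addr0 repr_mx1 scalemx1 => /matrixP.
    have [n_gt0 _] := (mx_irrP tau).1 irr_tau.
    move/(_ (Ordinal n_gt0) (Ordinal n_gt0))/eqP; rewrite !mxE eqxx.
    rewrite prodf_seq_eq0 => /hasP[x _ /=].
    rewrite invg1 oneg_ffun mxtrace_regular_mx ?inE // eqxx.
    by rewrite pnatr_eq0 eqn0Ngt cardG_gt0.
  have [x nz_gx] : exists x, g x != 1%g.
    apply/existsP; apply: contraR nz_g => /existsPn g1.
    apply/eqP/ffunP=> x; rewrite oneg_ffun.
    by have := g1 x; rewrite negbK => /eqP.
  rewrite (bigD1 x) //= mxtrace_regular_mx ?inE // invg_ffun eq_invg1.
  by rewrite (negPf nz_gx) mul0r scale0r.
exists (rho t); split=> //; apply: irr_conv_trace_rsim nz_t => //.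
by apply: mx_abs_irrW; apply: tensor_grepr_abs_irr => x; apply: splitF.
Qed.

(** For the converse, any factorization of [tau] serves: if its factor at [x] were nontrivial, the
    operators of that factor would sum to zero, against a trace computation. *)
Lemma in_triv_set (tau : representation F [set: gprod]) x :
    mx_irreducible tau ->
  (x \in triv_set tau) = (supported_group [set x] \subset rker tau).
Proof.
move=> irr_tau; apply/idP/idP; first exact: sub_rker_triv_set.
move=> /subsetP rk_x; rewrite inE; apply/asboolP.
have [rho [irr_rho sim_tau]] := irr_tensor_factors irr_tau.
exists rho; split=> //; apply: irr_rker_full_rsim_triv => //.
have := sum_normal_irr (irr_rho x) (normal_refl _); case: ifP => // _.
move/(congr1 mxtrace); rewrite linear0 raddf_sum /= => /eqP/idPn[].
(* As Gamma_x acts trivially on tau, the character of rho x is a nonzero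
   constant, so its sum over Gamma_x does not vanish. *)
have eq_tr (h : Gamma x) :
  \tr (rho x h) * (\prod_(y | y != x) rdegree (rho y))%:R = (rdegree tau)%:R.
  have sim_tr := mxtrace_rsim sim_tau (in_setT (dfung1 h)).
  have /rkerP[_ tau1] := rk_x _ (mem_dfung1_supported h (set11 x)).
  move: sim_tr; rewrite tau1 mxtrace1 mxtrace_tensor_grepr => ->.
  rewrite [RHS](bigD1 x) //= dfung1_id natr_prod; congr (_ * _).
  apply: eq_bigr => y ne_yx.
  by rewrite dfung1_dflt 1?eq_sym // repr_mx1 mxtrace1.
have [n_gt0 _] := (mx_irrP tau).1 irr_tau.
apply/negP=> /eqP sum0; have : (#|Gamma x| * rdegree tau)%:R == 0 :> F.
  rewrite natrM -cardsT mulr_natl -sumr_const.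
  under eq_bigr => h _ do rewrite -(eq_tr h).
  by rewrite -mulr_suml sum0 mul0r.
by rewrite pnatr_eq0 muln_eq0 -cardsT -!leqn0 leqNgt cardG_gt0 leqNgt n_gt0.
Qed.

(** G_S is generated by its single-coordinate elements, so the criterion for one point extends to
    [S]. *)
Lemma sub_triv_set (tau : representation F [set: gprod]) (S : {set E}) :
    mx_irreducible tau ->
  (S \subset triv_set tau) = (supported_group S \subset rker tau).
Proof.
move=> irr_tau; apply/subsetP/subsetP => [triv_S g Sg | rk_S x Sx].
  have -> : g = (\prod_x dfung1 (g x))%g.
    apply/ffunP=> x; rewrite prodg_ffun (big_only1 x) ?dfung1_id //.
    by move=> y ne_yx _; rewrite dfung1_dflt.
  apply: group_prod => x _; have [Sx | nSx] := boolP (x \in S).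
    have := triv_S x Sx; rewrite in_triv_set // => /subsetP; apply.
    by rewrite mem_dfung1_supported ?inE.
  rewrite (supported_groupP _ _ Sg) // (_ : dfung1 1 = 1)%g ?group1 //.
  by apply/ffunP=> y; rewrite oneg_ffun ffunE; case: dfwithP.
rewrite in_triv_set //; apply/subsetP=> g /supported_groupP gx.
apply: rk_S; apply/supported_groupP=> y nSy; apply: gx.
by rewrite inE; apply: contraNneq nSy => ->.
Qed.

End ClosedField.
End ProductGroupRepresentations.

(** * The character of the coset representation *)

Section CosetRepresentation.
Variables (F : fieldType) (gT : finGroupType) (G : {group gT}).

Lemma mxtrace_dadd_big (I : Type) (r : seq I) (tau : I -> representation F G)
    (x : gT) :
  \tr ((\big[dadd_grepr/grepr0]_(i <- r) tau i) x)
    = \sum_(i <- r) \tr (tau i x).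
Proof.
apply: (big_morph (fun T : representation F G => \tr (T x))) => /= [T1 T2|].
  by rewrite mxtrace_block.
by rewrite mxtrace1.
Qed.

Lemma mxtrace_lcoset_mx (H : {group gT}) (g : gT) :
  \tr (lcoset_mx F G H g) = #|[set C in lcosets H G | (g *: C)%g == C]|%:R.
Proof.
rewrite -[in RHS]sum1_card natr_sum.
transitivity (\sum_(C in lcosets H G) (C == g *: C)%g%:R : F).
  by rewrite big_enum_val; apply: eq_bigr => i _; rewrite mxE.
rewrite [LHS](bigID (fun C => (g *: C)%g == C)) /= [X in _ + X]big1 ?addr0.
  by apply: eq_big => [C|C /andP[_ /eqP ->]]; rewrite ?inE ?eqxx.
by move=> C /andP[_]; rewrite eq_sym => /negPf ->.
Qed.

(** Double counting of pairs (g, C) with [g] in [K] fixing [C]: the stabilizer of zH is a conjugate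
    of [H], and normality of [K] makes its intersection with [K] conjugate to that of [H]. *)
Lemma sum_mxtrace_lcoset_mx (H K : {group gT}) : (K <| G)%g ->
  \sum_(g in K) \tr (lcoset_mx F G H g) = (#|G : H| * #|K :&: H|)%:R%g.
Proof.
move=> /andP[sKG nKG].
under eq_bigr do rewrite mxtrace_lcoset_mx.
rewrite -natr_sum; congr _%:R.
under eq_bigr do rewrite -sum1dep_card.
rewrite (exchange_big_dep (mem (lcosets H G))) /= => [|g C _ /andP[] //].
rewrite -card_lcosets -sum_nat_const; apply: eq_bigr => _ /lcosetsP[z Gz ->].
rewrite sum1dep_card -[RHS](cardJg _ z^-1); congr #|pred_of_set _|.
have nKz : (K :^ z^-1 = K)%g by apply: (normsP nKG); rewrite groupV.
apply/setP=> g; rewrite conjIg nKz !inE; congr (_ && _).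
rewrite -lcosetM (sameP eqP lcoset_eqP) mem_lcoset mem_conjgV -conjgE.
suff -> : (z *: H)%g \in lcosets H G by [].
by apply/lcosetsP; exists z.
Qed.

End CosetRepresentation.

(** * Orders of projections and total degrees *)

Section ProjectionCount.
Variables (E : finType) (Gamma : E -> finGroupType).
Local Notation gprod := {dffun forall x : E, Gamma x}.

(** Restriction to [S] is a morphism with kernel G_{E-S}. *)
Lemma card_proj_image (S : {set E}) (H : {group gprod}) :
  (#|proj_image S H| * #|supported_group Gamma (~: S) :&: H| = #|H|)%N.
Proof.
have restrictM : {in [set: gprod] &, {morph Defs.restrict S : g h / (g * h)%g}}.
  by move=> g h _ _; apply/ffunP=> x; rewrite !(mulg_ffun, ffunE).
pose f := Morphism restrictM.
have kerf : ('ker f)%g = supported_group Gamma (~: S).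
  apply/setP=> g; apply/idP/supported_groupP => [/mker fg1 x | g1].
    rewrite inE negbK => Sx.
    by have /ffunP/(_ (Sub x Sx)) := fg1; rewrite oneg_ffun ffunE.
  apply/kerP; rewrite ?inE //; apply/ffunP=> x.
  by rewrite oneg_ffun ffunE g1 // inE negbK (valP x).
have -> : proj_image S H = (f @* H)%g by rewrite morphimE setTI.
by rewrite card_morphim setTI kerf mulnC setIC LagrangeI.
Qed.

Lemma proj_image_gt0 (S : {set E}) (H : {group gprod}) :
  (0 < #|proj_image S H|)%N.
Proof.
by rewrite card_gt0; apply/set0Pn; exists (Defs.restrict S 1%g); apply: imset_f.
Qed.

(** Gives r(∅) = 0, the value entering r^*(E). *)
Lemma card_proj_image0 (H : {group gprod}) : #|proj_image set0 H| = 1%N.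
Proof.
apply/eqP; rewrite -(eqn_pmul2r (cardG_gt0 H)) mul1n.
rewrite -[X in _ == X](card_proj_image set0) eqn_pmul2l ?proj_image_gt0 //.
apply/eqP/eq_card => g; rewrite inE andb_idl // => _.
by apply/supported_groupP=> x; rewrite !inE.
Qed.

Lemma sum_degree_triv_set (F : numClosedFieldType) (H : {group gprod}) (N : nat)
    (tau : 'I_N -> representation F [set: gprod]) (S : {set E}) :
    (forall i, mx_irreducible (tau i)) ->
    mx_rsim (lcoset_repr F [set: gprod] H)
            (\big[dadd_grepr/grepr0]_(i < N) tau i) ->
  ((\sum_(i | S \subset triv_set (tau i)) rdegree (tau i))
       * #|proj_image (~: S) H|
     = \prod_(x in ~: S) #|Gamma x|)%N.
Proof.
move=> irr_tau tau_dec; set d := (\sum_(i | _) _)%N.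
pose K := supported_group Gamma S.
(* Checked in [F], of characteristic zero, where both sides equal the sum of the coset character
   over [K]. *)
have dK : (d * #|K| = #|[set: gprod] : H|%g * #|K :&: H|)%N.
  apply/eqP; rewrite -(eqr_nat F).
  rewrite -sum_mxtrace_lcoset_mx ?supported_group_normal //.
  rewrite (eq_bigr (fun g => \sum_i \tr (tau i g))) => [|g _]; last first.
    by rewrite (mxtrace_rsim tau_dec) ?inE // mxtrace_dadd_big.
  rewrite exchange_big natrM natr_sum mulr_suml big_mkcond; apply/eqP.
  apply: eq_bigr => i _; rewrite -raddf_sum.
  rewrite (sum_normal_irr (irr_tau i) (supported_group_normal _ _)).
  rewrite -sub_triv_set //.
  case: ifP => _.
    by rewrite /= mxtrace_scalar mulr_natl.
  by rewrite raddf0.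
have K_gt0 := cardG_gt0 K; have KH_gt0 := cardG_gt0 (K :&: H).
have projH := card_proj_image (~: S) H; rewrite setCK -/K in projH.
(* Multiplied by |K| and |K ∩ H|, both sides become |G| |K ∩ H|. *)
apply/eqP; rewrite -(eqn_pmul2r K_gt0) card_supported_group.
have -> : (\prod_(x in ~: S) #|Gamma x| * \prod_(x in S) #|Gamma x|
            = #|[set: gprod]|)%N.
  rewrite cardsT card_dep_ffun foldrE big_map big_enum mulnC.
  rewrite [RHS](bigID (mem S)) /=.
  by congr (_ * _)%N; apply: eq_bigl => x; rewrite ?inE.
rewrite -card_supported_group -/K -(eqn_pmul2r KH_gt0).
rewrite [(d * _ * #|K|)%N]mulnAC -mulnA dK projH mulnAC.
by rewrite [(_ * #|H|)%N]mulnC Lagrange ?subsetT.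
Qed.

End ProjectionCount.

(** * Inclusion-exclusion over subsets of [E] *)

(** Expansion of the product over [x] of 1 - [x in A]. *)
Lemma set0_sum_sign (R : comNzRingType) (E : finType) (A : {set E}) :
  (A == set0)%:R = \sum_(S : {set E} | S \subset A) (-1) ^+ #|S| :> R.
Proof.
transitivity (\prod_x (- (x \in A)%:R + 1 : R)).
  have [->|/set0Pn[x Ax]] := eqVneq; last first.
    by rewrite (bigD1 x) //= Ax addNr mul0r.
  by rewrite big1 // => x _; rewrite inE oppr0 add0r.
rewrite bigA_distr [RHS]big_mkcond; apply: eq_bigr => S _.
rewrite -big_mkcond; case: ifPn => [/subsetP sSA | /subsetPn[x Sx nAx]].
  by rewrite (eq_bigr (fun=> -1)) ?prodr_const // => x /sSA ->.
by rewrite (bigD1 x) //= (negPf nAx) oppr0 mul0r.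
Qed.

(** A set lies in the intersection iff it lies in every A (f j), so for fixed [S] the sum over [f]
    factors into a power. *)
Lemma sum_prod_bigcap_set0 (R : comNzRingType) (E I J : finType)
    (A : I -> {set E}) (w : I -> R) :
  \sum_(f : {ffun J -> I} | \bigcap_j A (f j) == set0) \prod_j w (f j)
  = \sum_(S : {set E}) (-1) ^+ #|S| * (\sum_(i | S \subset A i) w i) ^+ #|J|.
Proof.
rewrite big_mkcond /=.
transitivity (\sum_(f : {ffun J -> I}) \sum_(S : {set E})
    (-1) ^+ #|S| * \prod_j (if S \subset A (f j) then w (f j) else 0)).
  apply: eq_bigr => f _.
  transitivity ((\bigcap_j A (f j) == set0)%:R * \prod_j w (f j)).
    by case: ifP; rewrite ?mul1r ?mul0r.
  rewrite set0_sum_sign mulr_suml big_mkcond; apply: eq_bigr => S _.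
  have [/bigcapsP sSA | nsSA] := ifPn.
    by congr (_ * _); apply: eq_bigr => j _; rewrite sSA.
  have [j nsSj] : exists j, ~~ (S \subset A (f j)).
    apply/existsP; apply: contraR nsSA => /existsPn sSA.
    by apply/bigcapsP=> j _; have := sSA j; rewrite negbK.
  by rewrite (bigD1 j) //= (negPf nsSj) mul0r mulr0.
rewrite exchange_big; apply: eq_bigr => S _; rewrite -mulr_sumr; congr (_ * _).
rewrite -(bigA_distr_bigA (fun _ i => if S \subset A i then w i else 0)) /=.
by rewrite prodr_const -big_mkcond.
Qed.

(** * Logarithms and the comparison of exponents *)

Lemma powR_log (R : realType) (b x : R) : 1 < b -> 0 < x -> b `^ log b x = x.
Proof.
move=> b_gt1 x_gt0; rewrite /powR gt_eqF ?(lt_trans ltr01) //.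
by rewrite /log divfK ?lnK // gt_eqF // ln_gt0.
Qed.

Lemma logM (R : realType) (b x y : R) :
  0 < x -> 0 < y -> log b (x * y) = log b x + log b y.
Proof. by move=> x_gt0 y_gt0; rewrite /log lnM ?posrE // mulrDl. Qed.

Lemma log_prod (R : realType) (b : R) (I : Type) (r : seq I) (P : pred I)
    (f : I -> R) :
  (forall i, 0 < f i) ->
  log b (\prod_(i <- r | P i) f i) = \sum_(i <- r | P i) log b (f i).
Proof.
move=> f_gt0; elim: r => [|i r IH]; first by rewrite !big_nil /log ln1 mul0r.
by rewrite !big_cons; case: ifP => _ //; rewrite logM ?IH ?prodr_gt0.
Qed.

Theorem theorem9p16 (R : realType) (E : finType) (Gamma : E -> finGroupType)
    (H : {group {dffun forall x : E, Gamma x}})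
    (N : nat)
    (tau : 'I_N -> representation R[i] [set: {dffun forall x : E, Gamma x}])
    (tau_irr : forall i : 'I_N, mx_irreducible (tau i))
    (tau_dec :
      mx_rsim (lcoset_repr R[i] [set: {dffun forall x : E, Gamma x}] H)
              (\big[dadd_grepr/grepr0]_(i < N) tau i))
    (b : R) (b_gt1 : 1 < b) (k : nat) (k_gt0 : (0 < k)%N) :
  \sum_(i : {ffun 'I_k -> 'I_N} | \bigcap_(j < k) triv_set (tau (i j)) == set0)
     \prod_(j < k) (rdegree (tau (i j)))%:R
  = char_poly_rank
      (dual_rank (fun x : E => log b #|Gamma x|%:R) (group_rank H b))
      (b ^+ k) :> R.
Proof.
rewrite (sum_prod_bigcap_set0 _ (fun i => triv_set (tau i))
           (fun i => (rdegree (tau i))%:R)).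
apply: eq_bigr => S _; congr (_ * _); rewrite card_ord.
set d := \sum_(i | _) _.
have b_gt0 : 0 < b by apply: lt_trans b_gt1.
set P := proj_image (~: S) H.
have P_gt0 : 0 < #|P|%:R :> R by rewrite ltr0n proj_image_gt0.
have G_gt0 x : 0 < #|Gamma x|%:R :> R by rewrite ltr0n -cardsT cardG_gt0.
have dP : d * #|P|%:R = \prod_(x in ~: S) #|Gamma x|%:R.
  by rewrite /d -natr_sum -natrM (sum_degree_triv_set _ tau_irr tau_dec) natr_prod.
(* The index set of the sum [d] is not visibly nonempty; positivity is read off the product
   formula. *)
have d_gt0 : 0 < d by rewrite -(pmulr_lgt0 _ P_gt0) dP prodr_gt0.
(* Comparing exponents suffices, since b^k raised to log_b d is d^k. *)
set r := dual_rank _ _; suff -> : r [set: E] - r S = log b d.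
  rewrite -powR_mulrn ?ltW // -powRrM mulrC powRrM powR_log //.
  by rewrite powR_mulrn // ltW.
have dlog : log b d + log b #|P|%:R = \sum_(x in ~: S) log b #|Gamma x|%:R.
  by rewrite -logM // dP log_prod.
have sumE : \sum_(x in [set: E]) log b #|Gamma x|%:R
    = \sum_(x in S) log b #|Gamma x|%:R + (log b d + log b #|P|%:R).
  rewrite dlog (bigID (mem S)) /=.
  by congr (_ + _); apply: eq_bigl => x; rewrite ?inE.
(* In r^*(E) - r^*(S) the two r(E) cancel and r(∅) = 0, leaving the sum of log_b |Gamma_x| over E-S
   minus r(E-S). *)
rewrite /r /dual_rank setCT /group_rank card_proj_image0 -/P sumE.
have -> : log b 1 = 0 by rewrite /log ln1 mul0r.
ring.
Qed.
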